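(* Let $G$ be a nilpotent Lie group such that its Lie algebra $\mathfrak{g}$ admits a nice basis and $Z(\mathfrak{g})\subset[\mathfrak{g},\mathfrak{g}]$ with $\dim[\mathfrak{g},\mathfrak{g}]-\dim Z(\mathfrak{g})=1$. Then, for any $(s^-,s^0,s^+)\in\mathbf{Sign}(\mathfrak{g})$, there exists a left-invariant Riemannian metric on $G$ for which the Ricci operator has signature $(s^-,s^0,s^+)$.
   Context: All Lie groups and Lie algebras are real and finite-dimensional. $Z(\mathfrak{g})$ is the center and $[\mathfrak{g},\mathfrak{g}]$ the derived ideal of $\mathfrak{g}$. A basis $(X_1,\ldots,X_n)$ of a nilpotent Lie algebra $\mathfrak{g}$ is called nice if: (1) for any $i\ne j$, either $[X_i,X_j]=0$ or there exists $k$ such that $[X_i,X_j]=C_{ij}^kX_k$ with $C_{ij}^k\neq0$; (2) if $[X_i,X_j]=C_{ij}^kX_k$ and $[X_s,X_r]=C_{sr}^kX_k$ with $C_{ij}^k\ne0$, $C_{sr}^k\neq0$ and $\{i,j\}\neq\{s,r\}$, then $\{i,j\}\cap\{s,r\}=\emptyset$. The signature of a symmetric operator $A$ on a Euclidean vector space $V$ is the triple $(s^-,s^0,s^+)$, where $s^+$ (resp. $s^-$) is the sum of the dimensions of the eigenspaces of $A$ for positive (resp. negative) eigenvalues and $s^0=\dim\ker A$. A left-invariant Riemannian metric $h$ on $G$ is the same as an inner product $\langle\cdot,\cdot\rangle$ on $\mathfrak{g}$; the Ricci operator of $(G,h)$ is the symmetric endomorphism $\mathrm{Ric}$ of $\mathfrak{g}=T_eG$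 with $\langle \mathrm{Ric}(u),v\rangle=\mathrm{ric}(u,v)$, where $\mathrm{ric}$ is the Ricci tensor of $h$ at $e$ (standard sign convention, for which round spheres have positive Ricci curvature). For a nilpotent Lie algebra $\mathfrak{g}$ of dimension $n$, put $d=\dim[\mathfrak{g},\mathfrak{g}]$, $k=\dim Z(\mathfrak{g})$, $\ell=\dim(Z(\mathfrak{g})\cap[\mathfrak{g},\mathfrak{g}])$. Then $$\mathbf{Sign}(\mathfrak{g})=\{(n-d-p+m^-,\;p+m^0,\;\ell+m^+):\ \max(k-d,0)\le p\le k-\ell,\ m^-+m^0+m^+=d-\ell\},$$ where $p,m^-,m^0,m^+$ range over nonnegative integers. *)

(* Defs.v *)
From HB Require Import structures.
From mathcomp Require Import all_boot all_order all_algebra.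
From mathcomp Require Import boolp classical_sets fsbigop reals.

Set Implicit Arguments.
Unset Strict Implicit.
Unset Printing Implicit Defensive.

Import Order.TTheory GRing.Theory Num.Theory.
Local Open Scope ring_scope.

HB.mixin Record Vector_isLieAlgebra (K : fieldType) V of Vector K V := {
  lie : V -> V -> V;
  lie_is_bilinear : bilinear_for *:%R *:%R lie;
  liexx : forall x, lie x x = 0;
  lie_jacobi : forall x y z,
    lie x (lie y z) + lie y (lie z x) + lie z (lie x y) = 0
}.

#[short(type="lieAlgType")]
HB.structure Definition LieAlgebra (K : fieldType) :=
  { V of Vector_isLieAlgebra K V & Vector K V }.

Notation "[ 'Lie' x , y ]" := (lie x y)
  (at level 0, x at level 99, y at level 99, format "[ 'Lie'  x ,  y ]")
  : ring_scope.

HB.instance Definition _ (K : fieldType) (g : lieAlgType K) :=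
  bilinear_isBilinear.Build K g g g *:%R *:%R (@lie K g)
    (@lie_is_bilinear K g).

HB.instance Definition _ (K : fieldType) (g : lieAlgType K) (x : g) :=
  GRing.isLinear.Build K g g *:%R (lie x) ((@lie_is_bilinear K g).2 x).

Section LieAlgebraTheory.
Context {K : fieldType} {g : lieAlgType K}.
Implicit Types (x y : g) (U V : {vspace g}).

Definition ad x : 'End(g) := linfun (lie x).

Definition lie_center : {vspace g} := lker (linfun ad).

Definition lie_prodv U V : {vspace g} :=
  <<[seq [Lie x, y] | x <- vbasis U, y <- vbasis V]>>%VS.

Definition lie_derived : {vspace g} := lie_prodv fullv fullv.

Definition lower_central (m : nat) : {vspace g} :=
  iter m (lie_prodv fullv) fullv.

Definition lie_nilpotent : Prop := exists m, lower_central m = 0%VS.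

Definition nice_basis (X : (\dim {:g}).-tuple g) : Prop :=
  [/\ basis_of fullv X,
      forall i j : 'I_(\dim {:g}), i != j ->
        [Lie X`_i, X`_j] = 0 \/
        exists k : 'I_(\dim {:g}), exists2 c : K,
          c != 0 & [Lie X`_i, X`_j] = c *: X`_k
    & forall (i j s r k : 'I_(\dim {:g})) (c c' : K),
        c != 0 -> c' != 0 ->
        [Lie X`_i, X`_j] = c *: X`_k -> [Lie X`_s, X`_r] = c' *: X`_k ->
        [set i; j] != [set s; r] -> [disjoint [set i; j] & [set s; r]]].

Lemma adE x y : ad x y = [Lie x, y].
Proof. by rewrite lfunE. Qed.

Lemma ad_is_linear : linear ad.
Proof.
move=> a x y; apply/lfunP => z.
by rewrite adE add_lfunE scale_lfunE !adE linearPl.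
Qed.

HB.instance Definition _ :=
  GRing.isLinear.Build K g 'End(g) *:%R ad ad_is_linear.

Lemma mem_lie_center x :
  reflect (forall y, [Lie x, y] = 0) (x \in lie_center).
Proof.
rewrite memv_ker lfunE; apply: (iffP eqP) => [adx0 y | x0].
  by rewrite -adE adx0 lfunE.
by apply/lfunP => y; rewrite adE x0 lfunE.
Qed.

Lemma memv_lie_prod U V x y :
  x \in U -> y \in V -> [Lie x, y] \in lie_prodv U V.
Proof.
move=> /coord_vbasis-> /coord_vbasis->.
rewrite linear_sumr rpred_sum // => j _; rewrite linear_sumlz rpred_sum // => i _.
rewrite linearZl_LR linearZr_LR !rpredZ // memv_span //.
by apply: allpairs_f; rewrite mem_nth // size_tuple.
Qed.

Lemma lie_prodv_sub U V (W : {vspace g}) :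
  (forall x y, x \in U -> y \in V -> [Lie x, y] \in W) ->
  (lie_prodv U V <= W)%VS.
Proof.
move=> UVW; apply/span_subvP => _ /allpairsP[[x y] /= [xU yV ->]].
by apply: UVW; apply: vbasis_mem.
Qed.

End LieAlgebraTheory.

Arguments lie_center {K} g.
Arguments lie_derived {K} g.
Arguments lower_central {K} g m.
Arguments lie_nilpotent {K} g.

Section Trace.
Context {K : fieldType} {V : vectType K}.

(* Meaningful for linear [f] only. *)
Definition fun_trace (f : V -> V) : K :=
  \sum_(i < \dim {:V}) coord (vbasis {:V}) i (f (vbasis {:V})`_i).

End Trace.

Section LeftInvariantMetrics.
Context {R : realType} {g : lieAlgType R}.

(* A left-invariant Riemannian metric on a Lie group G with Lie algebra g is  *)
(* an inner product [ip] on g. Its Levi-Civita connection is determined by    *)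
(* its restriction to left-invariant fields, which is a product [nabla] on g; *)
(* as <v, w> is constant for left-invariant v, w, metric compatibility says   *)
(* that each [nabla u] is skew-symmetric.                                     *)
Definition levi_civita (ip : {dot g for idfun})
    (nabla : {bilinear g -> g -> g}) : Prop :=
  (forall u v, nabla u v - nabla v u = [Lie u, v]) /\
  (forall u v w, ip (nabla u v) w + ip v (nabla u w) = 0).

Definition curvature (nabla : g -> g -> g) (u v w : g) : g :=
  nabla u (nabla v w) - nabla v (nabla u w) - nabla [Lie u, v] w.

(* ric(u, v) = tr (w |-> R(w, u) v), which is positive on round spheres.      *)
Definition ricci_tensor (nabla : g -> g -> g) (u v : g) : R :=
  fun_trace (fun w => curvature nabla w u v).

Definition ricci_operator (ip : {dot g for idfun}) (A : 'End(g)) : Prop :=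
  exists2 nabla : {bilinear g -> g -> g}, levi_civita ip nabla &
    forall u v, ip (A u) v = ricci_tensor nabla u v.

End LeftInvariantMetrics.

Section Signature.
Context {R : realType}.
Local Open Scope classical_set_scope.

(* The sums have finite support, the eigenspaces of all but finitely many     *)
(* scalars being 0.                                                           *)
Definition signature (V : vectType R) (A : 'End(V)) : nat * nat * nat :=
  (\big[addn/0%N]_(a \in [set a : R | a < 0]) \dim (passmx.leigenspace A a),
   \dim (lker A),
   \big[addn/0%N]_(a \in [set a : R | 0 < a]) \dim (passmx.leigenspace A a)).

(* No subtraction below truncates when [k - d <= p <= k - l], except that     *)
(* [k - d] itself stands for max(k - d, 0).                                   *)
Definition Sign (g : lieAlgType R) : set (nat * nat * nat) :=
  let n := \dim {:g} in
  let d := \dim (lie_derived g) in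
  let k := \dim (lie_center g) in
  let l := \dim (lie_center g :&: lie_derived g)%VS in
  [set s | exists p mm m0 mp : nat,
    [/\ (k - d <= p <= k - l)%N,
        (mm + m0 + mp = d - l)%N
      & s = (n - d - p + mm, p + m0, l + mp)%N]].

End Signature.

(* Main.v *)
(* In an orthonormal basis e with structure coefficients c, the Ricci tensor   *)
(* of a nilpotent Lie algebra is                                              *)
(*   ric(e_i, e_j) = - 1/2 \sum_(w, m) c_iwm c_jwm                            *)
(*                   + 1/4 \sum_(w, m) c_wmi c_wmj,                           *)
(* the trace and Killing terms being 0. If e is nice, this is diagonal, and   *)
(* the center and the derived ideal are spanned by parts of e. A basis vector *)
(* outside [g, g] then has a negative Ricci eigenvalue, a central one a       *)
(* positive eigenvalue, and there is exactly one other basis vector X_m, for  *)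
(* which both sums are nonzero. Replacing X_m by t X_m keeps the basis nice   *)
(* and multiplies the two sums by t^2 and t^-2, so that the remaining         *)
(* eigenvalue takes any prescribed sign.                                      *)

Require Import Defs.
From HB Require Import structures.
From mathcomp Require Import all_boot all_order all_algebra.
From mathcomp Require Import boolp classical_sets fsbigop reals.
From mathcomp Require Import ring lra.

Set Implicit Arguments.
Unset Strict Implicit.
Unset Printing Implicit Defensive.

Import Order.TTheory GRing.Theory Num.Theory.
Local Open Scope ring_scope.

(** As the center lies in the derived ideal with codimension one, [Sign] forces p = 0, and its
    elements are (n - d, 0, k) with one unit added to one of the three entries. The metrics used
    make a rescaled nice basis orthonormal. Niceness makes the Ricci tensor diagonal
    ([ricci_tensor_diag]) and turns center and derived ideal into index sets ([lie_center_nice],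
    [lie_derived_nice]), which fixes the sign of every eigenvalue but one. Rescaling the remaining
    basis vector shifts the balance between the negative and the positive part of its eigenvalue
    ([exists_scaling], [exists_ricci_sg]). Nilpotency enters through [nice_coef_acyclic], which
    removes the trace and Killing terms. *)

(** * Coordinates in a basis, traces and coordinate subspaces *)

Section Coordinates.
Context {K : fieldType} {V : vectType K}.
Variable e : (\dim {:V}).-tuple V.
Hypothesis e_basis : basis_of fullv e.

Lemma coord_fullv v : v = \sum_i coord e i v *: e`_i.
Proof. exact: (coord_basis e_basis (memvf v)). Qed.

Lemma coord_basisE (i j : 'I_(\dim {:V})) : coord e j e`_i = (i == j)%:R.
Proof. exact/coord_free/(basis_free e_basis). Qed.

Lemma coord_inj u v : (forall i, coord e i u = coord e i v) -> u = v.
Proof.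
by move=> uv; rewrite [u]coord_fullv [v]coord_fullv; apply: eq_bigr => i _; rewrite uv.
Qed.

Lemma linear_coordE (U : lmodType K) (f : {linear V -> U}) v :
  f v = \sum_i coord e i v *: f e`_i.
Proof.
by rewrite {1}[v]coord_fullv linear_sum; apply: eq_bigr => i _; rewrite linearZ.
Qed.

(** Independence of the trace from the basis: expand the vectors of [vbasis] in [e], exchange the
    sums, and collect the expansion of [e] in [vbasis]. *)
Lemma fun_traceE (f : {linear V -> V}) :
  fun_trace f = \sum_i coord e i (f e`_i).
Proof.
rewrite /fun_trace.
under eq_bigr do rewrite linear_coordE linear_sum.
rewrite exchange_big; apply: eq_bigr => i _ /=.
rewrite [X in coord e i X](coord_vbasis (memvf _)) linear_sum.
by apply: eq_bigr => j _; rewrite !linearZ /= mulrC.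
Qed.

Lemma biscalar_ext (f h : V -> V -> K) :
  bilinear_for *%R *%R f -> bilinear_for *%R *%R h ->
  (forall i j : 'I_(\dim {:V}), f e`_i e`_j = h e`_i e`_j) -> f =2 h.
Proof.
move=> f_bil h_bil fh u v.
have expand k : bilinear_for *%R *%R k ->
    k u v = \sum_i \sum_j coord e i u * (coord e j v * k e`_i e`_j).
  move=> [k_l k_r].
  (* Scalars are viewed as the module [K^o], so that [linear_coordE] applies to each argument. *)
  pose kl w : {linear V -> K^o} := HB.pack (k^~ w)
    (GRing.isLinear.Build K V K^o *:%R (k^~ w) (k_l w)).
  pose kr w : {linear V -> K^o} := HB.pack (k w)
    (GRing.isLinear.Build K V K^o *:%R (k w) (k_r w)).
  rewrite -[LHS]/(kl v u) linear_coordE; apply: eq_bigr => i _.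
  by rewrite -[kl v _]/(kr e`_i v) linear_coordE scaler_sumr.
rewrite (expand f) // (expand h) //.
by apply: eq_bigr => i _; apply: eq_bigr => j _; rewrite fh.
Qed.

(** Eigenspaces, the center and the derived ideal all take this form, which turns dimensions into
    cardinalities. *)
Definition coord_span_set (S : {set 'I_(\dim {:V})}) : {vspace V} :=
  <<[seq e`_i | i : 'I_(\dim {:V}) in S]>>%VS.

Lemma mem_coord_span_set S v :
  v \in coord_span_set S <-> (forall i, i \notin S -> coord e i v = 0).
Proof.
split=> [vS i iS|v0].
  pose W := lker (linfun (coord e i : V -> K^o)).
  have /subvP SW : (coord_span_set S <= W)%VS; last first.
    by have := SW v vS; rewrite memv_ker lfunE => /eqP.
  apply/span_subvP => x /mapP[j]; rewrite mem_enum => jS ->.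
  rewrite memv_ker lfunE /= coord_basisE.
  by have [ji|//] := eqVneq j i; rewrite -ji jS in iS.
rewrite [v]coord_fullv; apply: rpred_sum => i _.
have [iS|iS] := boolP (i \in S); last by rewrite v0 // scale0r rpred0.
by apply/rpredZ/memv_span/mapP; exists i; rewrite ?mem_enum.
Qed.

Lemma dim_coord_span_set S : \dim (coord_span_set S) = #|S|.
Proof.
have e_inj : injective (fun i : 'I_(\dim {:V}) => e`_i).
  move=> i j /(congr1 (coord e i)) /eqP.
  by rewrite !coord_basisE eqxx; have [//|_] := eqVneq j i; rewrite oner_eq0.
suff /eqP -> : free [seq e`_i | i : 'I_(\dim {:V}) in S] by rewrite size_image.
pose P v := v \in [seq e`_i | i : 'I_(\dim {:V}) in S].
rewrite (@perm_free _ _ _ (filter P e)) ?filter_free ?(basis_free e_basis) //.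
apply: uniq_perm => [||v].
- by rewrite map_inj_uniq ?enum_uniq.
- by rewrite filter_uniq ?free_uniq ?(basis_free e_basis).
rewrite mem_filter; apply/idP/andP => [Pv|[]//]; split=> //.
by have /mapP[i _ ->] := Pv; rewrite mem_nth ?size_tuple.
Qed.

End Coordinates.

(** * Signature of an operator that is diagonal in a basis *)

Section DiagonalOperator.
Context {R : realType} {V : vectType R}.
Variable e : (\dim {:V}).-tuple V.
Hypothesis e_basis : basis_of fullv e.
Variables (A : 'End(V)) (r : 'I_(\dim {:V}) -> R).
Hypothesis A_diag : forall i : 'I_(\dim {:V}), A e`_i = r i *: e`_i.

Lemma coord_diag_operator i v : coord e i (A v) = r i * coord e i v.
Proof.
rewrite (linear_coordE e_basis) linear_sum (bigD1 i) //= big1 => [|j ji].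
  by rewrite A_diag !linearZ /= coord_basisE // eqxx mulr1 addr0 mulrC.
by rewrite A_diag !linearZ /= coord_basisE // (negPf ji) !mulr0.
Qed.

(** [A - a] multiplies coordinate [i] by [r i - a], so its kernel is spanned by the basis vectors
    with [r i = a]. *)
Lemma dim_leigenspace_diag a :
  \dim (passmx.leigenspace A a) = #|[set i | r i == a]|.
Proof.
rewrite -(dim_coord_span_set e_basis); congr (\dim _); apply/vspaceP => v.
rewrite memv_ker add_lfunE opp_lfunE scale_lfunE id_lfunE subr_eq0.
apply/eqP/idP => [Av|].
  apply/(mem_coord_span_set e_basis) => i; rewrite inE => ra.
  have /eqP := congr1 (coord e i) Av; rewrite linearZ /= coord_diag_operator.
  by rewrite -subr_eq0 -mulrBl mulf_eq0 subr_eq0 (negPf ra) => /eqP.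
move/(mem_coord_span_set e_basis) => v0; apply: (coord_inj e_basis) => i.
rewrite linearZ coord_diag_operator /=.
have [->//|ra] := eqVneq (r i) a.
by rewrite v0 ?inE // !mulr0.
Qed.

Lemma sum_dim_leigenspace_diag (P : set R) :
  \big[addn/0%N]_(a \in P) \dim (passmx.leigenspace A a) =
  #|[set i | r i \in P]|.
Proof.
(* Only values of [r] have nonzero eigenspaces; removing duplicates counts each index once. *)
pose s := [seq a <- undup (map r (enum 'I_(\dim {:V}))) | a \in P].
have mem_s i : (r i \in s) = (r i \in P).
  by rewrite mem_filter mem_undup map_f ?mem_enum ?andbT.
have s_uniq : uniq s by rewrite filter_uniq ?undup_uniq.
rewrite (fsbigE s) //; last 2 first.
- by move=> a /=; rewrite mem_filter => /andP[/set_mem].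
- move=> a Pa as_; have {}Pa : a \in P by rewrite inE.
  rewrite dim_leigenspace_diag; apply: eq_card0 => i; rewrite inE.
  by apply: contraNF as_ => /eqP ria; rewrite -ria mem_s ria.
under eq_bigr do rewrite dim_leigenspace_diag -sum1dep_card big_mkcond.
rewrite exchange_big -sum1dep_card [RHS]big_mkcond; apply: eq_bigr => i _ /=.
case: ifPn => rP.
  rewrite big_mkcond (bigD1_seq (r i)) //=; last by rewrite mem_s.
  rewrite rP eqxx big1 // => a ar.
  by rewrite eq_sym (negPf ar) if_same.
rewrite big1 // => a aP; case: eqP => // ra.
by rewrite ra aP in rP.
Qed.

Lemma signature_diag : signature A =
  (#|[set i | (r i < 0)%R]|, #|[set i | r i == 0]|, #|[set i | (0 < r i)%R]|).
Proof.
rewrite /signature !sum_dim_leigenspace_diag; congr (_, _, _).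
- by apply: eq_card => i; rewrite !finset.in_set; apply/idP/idP; rewrite inE.
- rewrite -dim_leigenspace_diag; congr (\dim _).
  by rewrite /passmx.leigenspace scale0r subr0.
- by apply: eq_card => i; rewrite !finset.in_set; apply/idP/idP; rewrite inE.
Qed.

End DiagonalOperator.

(** * The inner product for which a given basis is orthonormal *)

Section OrthonormalBasis.
Context {R : realType} {V : vectType R}.
Variable e : (\dim {:V}).-tuple V.
Hypothesis e_basis : basis_of fullv e.

Definition coord_dot (u v : V) : R := \sum_i coord e i u * coord e i v.

Lemma coord_dotC u v : coord_dot u v = coord_dot v u.
Proof. by apply: eq_bigr => i _; rewrite mulrC. Qed.

Lemma coord_dotPr u a v w :
  coord_dot u (a *: v + w) = a * coord_dot u v + coord_dot u w.
Proof.
rewrite /coord_dot mulr_sumr -big_split; apply: eq_bigr => i _ /=.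
by rewrite linearP mulrDr mulrCA.
Qed.

Lemma coord_dotPl u a v w :
  coord_dot (a *: v + w) u = a * coord_dot v u + coord_dot w u.
Proof. by rewrite !(coord_dotC _ u) coord_dotPr. Qed.

Lemma coord_dot_bilinear : bilinear_for *%R *%R coord_dot.
Proof. by split=> u a v w; [exact: coord_dotPl | exact: coord_dotPr]. Qed.

Lemma coord_dotNl u v : coord_dot (- u) v = - coord_dot u v.
Proof. by rewrite -sumrN; apply: eq_bigr => i _; rewrite linearN mulNr. Qed.

Lemma coord_dot_gt0 u : u != 0 -> 0 < coord_dot u u.
Proof.
move=> u_neq0; rewrite lt_neqAle sumr_ge0 ?andbT => [|i _]; last exact: sqr_ge0.
apply: contra u_neq0; rewrite eq_sym psumr_eq0 => [/allP u0|i _]; last exact: sqr_ge0.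
apply/eqP/(coord_inj e_basis) => i; rewrite linear0.
by apply/eqP; have:= u0 i (mem_index_enum i); rewrite mulf_eq0 orbb.
Qed.

Lemma coord_dot_basis u (i : 'I_(\dim {:V})) : coord_dot u e`_i = coord e i u.
Proof.
rewrite /coord_dot (bigD1 i) //= coord_basisE // eqxx mulr1 big1 ?addr0 // => j ji.
by rewrite coord_basisE // eq_sym (negPf ji) mulr0.
Qed.

Lemma exists_coord_dot : exists ip : {dot V for idfun}, ip =2 coord_dot.
Proof.
pose B := bilinear_isBilinear.Build R V V R *%R *%R coord_dot coord_dot_bilinear.
have herm x y : coord_dot x y = (-1) ^+ false * idfun (coord_dot y x).
  by rewrite mul1r coord_dotC.
pose H := isHermitianSesquilinear.Build R V false idfun coord_dot herm.
pose D := isDotProduct.Build R V coord_dot coord_dot_gt0.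
pose ip : {dot V for idfun} := HB.pack coord_dot B H D.
by exists ip.
Qed.

End OrthonormalBasis.

(** Exchanging the summation indices shows that twice a double sum is the sum of the symmetrized
    terms. *)
Lemma sum_eq_symmetrized (R : numDomainType) (I : finType) (F G : I -> I -> R) :
  (forall i j, F i j + F j i = G i j + G j i) ->
  \sum_i \sum_j F i j = \sum_i \sum_j G i j.
Proof.
have dbl H : (\sum_i \sum_j H i j) *+ 2 = \sum_i \sum_j (H i j + H j i) :> R.
  under [RHS]eq_bigr do rewrite big_split.
  by rewrite big_split mulr2n; congr (_ + _); exact: exchange_big.
move=> FG; apply/eqP; rewrite -(eqr_pMn2r (isT : (0 < 2)%N)) !dbl; apply/eqP.
by apply: eq_bigr => i _; apply: eq_bigr => j _; exact: FG.
Qed.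

(** * The Levi-Civita connection from the Koszul formula *)

Section KoszulConnection.
Context {R : realType} {g : lieAlgType R}.
Local Notation n := (\dim {:g}).
Variable e : n.-tuple g.

(** The Koszul formula for left-invariant fields: inner products are constant, so only the bracket
    terms survive. *)
Definition koszul (u v : g) : g :=
  \sum_(k < n) 2^-1 * (coord_dot e [Lie u, v] e`_k - coord_dot e [Lie v, e`_k] u
                 + coord_dot e [Lie e`_k, u] v) *: e`_k.

Definition struct_coef (i j k : 'I_n) : R := coord e k [Lie e`_i, e`_j].

Definition ricci_diag (i : 'I_n) : R :=
  \sum_w \sum_m (- 2^-1 * struct_coef i w m ^+ 2
                 + 4^-1 * struct_coef w m i ^+ 2).

Lemma lie_Pl (a : R) (x y z : g) :
  [Lie a *: x + y, z] = a *: [Lie x, z] + [Lie y, z].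
Proof. exact: linearPl. Qed.

Lemma lie_Pr (a : R) (x y z : g) :
  [Lie z, a *: x + y] = a *: [Lie z, x] + [Lie z, y].
Proof. exact: linearPr. Qed.

Lemma lieC (x y : g) : [Lie x, y] = - [Lie y, x].
Proof.
apply/eqP; rewrite -addr_eq0; apply/eqP.
have := liexx (x + y).
by rewrite linearDl !linearDr /= !liexx add0r addr0.
Qed.

Lemma struct_coefC i j k : struct_coef i j k = - struct_coef j i k.
Proof. by rewrite /struct_coef lieC linearN. Qed.

Lemma struct_coefxx i k : struct_coef i i k = 0.
Proof. by rewrite /struct_coef liexx linear0. Qed.

Lemma koszul_bilinear : bilinear_for *:%R *:%R koszul.
Proof.
split=> [v a x y|u a x y]; rewrite /= /koszul scaler_sumr -big_split;
  apply: eq_bigr => k _ /=; rewrite scalerA -scalerDl; congr (_ *: _).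
  by rewrite lie_Pl lie_Pr coord_dotPr !coord_dotPl; ring.
by rewrite lie_Pl lie_Pr coord_dotPr !coord_dotPl; ring.
Qed.

Hypothesis e_basis : basis_of fullv e.

Lemma coord_koszul u v (k : 'I_n) : coord e k (koszul u v) =
  2^-1 * (coord_dot e [Lie u, v] e`_k - coord_dot e [Lie v, e`_k] u
          + coord_dot e [Lie e`_k, u] v).
Proof. by rewrite coord_sum_free // (basis_free e_basis). Qed.

Lemma coord_koszul_basis (i j k : 'I_n) : coord e k (koszul e`_i e`_j) =
  2^-1 * (struct_coef i j k - struct_coef j k i + struct_coef k i j).
Proof. by rewrite coord_koszul !coord_dot_basis. Qed.

Lemma koszul_dot u v w : coord_dot e (koszul u v) w =
  2^-1 * (coord_dot e [Lie u, v] w - coord_dot e [Lie v, w] u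
          + coord_dot e [Lie w, u] v).
Proof.
(* The difference of the two sides is linear in [w], so it is enough that it vanishes on [e]. *)
pose f x : R^o := coord_dot e (koszul u v) x - 2^-1 *
 (coord_dot e [Lie u, v] x - coord_dot e [Lie v, x] u + coord_dot e [Lie x, u] v).
have f_lin : linear f.
  by move=> a x y; rewrite /f lie_Pl lie_Pr !coord_dotPr !coord_dotPl /GRing.scale /=;
    ring.
pose fl : {linear g -> R^o} := HB.pack f (GRing.isLinear.Build R g R^o *:%R f f_lin).
apply/eqP; rewrite -subr_eq0 -[X in X == 0]/(fl w) (linear_coordE e_basis).
rewrite big1 // => k _.
by rewrite /= /f coord_dot_basis // coord_koszul subrr scaler0.
Qed.

Lemma exists_levi_civita (ip : {dot g for idfun}) : ip =2 coord_dot e ->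
  exists2 nabla : {bilinear g -> g -> g}, levi_civita ip nabla & nabla =2 koszul.
Proof.
move=> ipE; pose nabla : {bilinear g -> g -> g} :=
  HB.pack koszul (bilinear_isBilinear.Build R g g g *:%R *:%R koszul koszul_bilinear).
exists nabla => //; split=> [u v|u v w]; rewrite -![nabla _ _]/(koszul _ _).
  apply: (coord_inj e_basis) => k; rewrite linearB /= !coord_koszul.
  rewrite (lieC v u) (lieC u e`_k) (lieC v e`_k) -(coord_dot_basis e_basis).
  by rewrite !coord_dotNl; field.
rewrite !ipE (coord_dotC e v) !koszul_dot.
rewrite (lieC w v) (lieC u w) (lieC u v).
by rewrite !coord_dotNl; field.
Qed.


(** * The Ricci tensor in structure coefficients *)

Section RicciTensor.
Variable nabla : {bilinear g -> g -> g}.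

Lemma bilinear_Pl a x y z : nabla (a *: x + y) z = a *: nabla x z + nabla y z.
Proof. exact: linearPl. Qed.

Lemma bilinear_Pr a x y z : nabla z (a *: x + y) = a *: nabla z x + nabla z y.
Proof. exact: linearPr. Qed.

Lemma coord_bilinear u v k : coord e k (nabla u v) =
  \sum_m coord e m v * coord e k (nabla u e`_m).
Proof.
have lin : linear (nabla u) by move=> a x y; exact: bilinear_Pr.
pose f : {linear g -> g} := HB.pack (nabla u : g -> g)
  (GRing.isLinear.Build R g g *:%R (nabla u) lin).
rewrite -[nabla u v]/(f v) (linear_coordE e_basis) linear_sum.
by apply: eq_bigr => m _; rewrite linearZ.
Qed.

Lemma ricci_tensorE u v :
  ricci_tensor nabla u v = \sum_w coord e w (curvature nabla e`_w u v).
Proof.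
have lin : linear (fun w => curvature nabla w u v).
  move=> a x y; rewrite /curvature lie_Pl !bilinear_Pl !bilinear_Pr.
  apply: (coord_inj e_basis) => k.
  by rewrite !(linearB, linearD, linearZ) /=; ring.
pose f : {linear g -> g} := HB.pack (fun w => curvature nabla w u v)
  (GRing.isLinear.Build R g g *:%R (fun w => curvature nabla w u v) lin).
exact: (fun_traceE e_basis f).
Qed.

Lemma ricci_tensor_bilinear : bilinear_for *%R *%R (ricci_tensor nabla).
Proof.
split=> [v a x y|u a x y]; rewrite /= !ricci_tensorE mulr_sumr -big_split;
  apply: eq_bigr => w _ /=; rewrite /curvature ?lie_Pr ?bilinear_Pl ?bilinear_Pr.
  by rewrite !(linearB, linearD, linearZ) /=; ring.
by rewrite !(linearB, linearD, linearZ) /=; ring.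
Qed.

Lemma coord_bilinear_l u v k : coord e k (nabla u v) =
  \sum_m coord e m u * coord e k (nabla e`_m v).
Proof.
have lin : linear (nabla^~ v) by move=> a x y; exact: bilinear_Pl.
pose f : {linear g -> g} := HB.pack (nabla^~ v)
  (GRing.isLinear.Build R g g *:%R (nabla^~ v) lin).
rewrite -[nabla u v]/(f u) (linear_coordE e_basis) linear_sum.
by apply: eq_bigr => m _; rewrite linearZ.
Qed.

Hypothesis nablaE : nabla =2 koszul.
(* A product of this form that does not vanish makes [e`_m] and [e`_w]        *)
(* iterated brackets of each other; this is the only way in which nilpotency  *)
(* is used, and it makes each term of [tr (ad _)] and [tr (ad _ \o ad _)] 0.  *)
Hypothesis coef_acyclic :
  forall i j w m, struct_coef j w m * struct_coef i m w = 0.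

Lemma struct_coef_trace i w : struct_coef i w w = 0.
Proof. by apply/eqP; have /eqP := coef_acyclic i i w w; rewrite mulf_eq0 orbb. Qed.

Lemma ricci_tensor_basis (i j : 'I_n) : ricci_tensor nabla e`_i e`_j =
  \sum_w \sum_m (- 2^-1 * (struct_coef i w m * struct_coef j w m)
                 + 4^-1 * (struct_coef w m i * struct_coef w m j)).
Proof.
have coord_nabla (a b k : 'I_n) : coord e k (nabla e`_a e`_b) =
    2^-1 * (struct_coef a b k - struct_coef b k a + struct_coef k a b).
  by rewrite nablaE coord_koszul_basis.
rewrite ricci_tensorE.
transitivity (- \sum_(w < n) \sum_(m < n)
  (coord e m (nabla e`_w e`_j) * coord e w (nabla e`_i e`_m)
   + struct_coef w i m * coord e w (nabla e`_m e`_j))).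
  rewrite -sumrN; apply: eq_bigr => w _; rewrite /curvature !linearB /=.
  rewrite 2!coord_bilinear [X in _ - _ - X]coord_bilinear_l -!sumrB -sumrN.
  (* The first curvature term drops out: the [w] coordinate of [nabla e_w e_m] involves only
     vanishing coefficients, those with a repeated index. *)
  apply: eq_bigr => m _; rewrite (coord_nabla w m w).
  rewrite (struct_coefC m w w) (struct_coefC w m w) !struct_coef_trace struct_coefxx.
  by rewrite /struct_coef; ring.
under eq_bigr do rewrite big_split.
rewrite big_split /= [X in _ + X]exchange_big -big_split /=.
under eq_bigr do rewrite -big_split /=.
rewrite -sumrN; under [LHS]eq_bigr do rewrite -sumrN.
(* Products such as c_jwm c_wmi cancel against those with [w] and [m] exchanged; [N1] and [N2]
   remove the Killing-type products. *)
apply: sum_eq_symmetrized => w m.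
have N1 := coef_acyclic i j w m; have N2 := coef_acyclic j i w m.
rewrite !coord_nabla.
rewrite (struct_coefC w j m) (struct_coefC m j w) (struct_coefC w i m).
rewrite (struct_coefC m i w) (struct_coefC w m i) (struct_coefC w m j).
lra.
Qed.

Hypothesis coef_fun :
  forall i j k k', struct_coef i j k != 0 -> struct_coef i j k' != 0 -> k = k'.
Hypothesis coef_inj :
  forall i i' j k, struct_coef i j k != 0 -> struct_coef i' j k != 0 -> i = i'.

(** For distinct [i] and [j], a nonzero c_iwm c_jwm would contradict [coef_inj], and a nonzero c_wmi
    c_wmj would contradict [coef_fun]. *)
Lemma ricci_tensor_diag (i j : 'I_n) :
  ricci_tensor nabla e`_i e`_j = (i == j)%:R * ricci_diag i.
Proof.
rewrite ricci_tensor_basis /ricci_diag mulr_sumr; apply: eq_bigr => w _.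
rewrite mulr_sumr; apply: eq_bigr => m _.
have [<-|/eqP ij] := eqVneq i j; first by rewrite mul1r !expr2.
have -> : struct_coef i w m * struct_coef j w m = 0.
  apply/eqP/negPn/negP; rewrite mulf_eq0 negb_or => /andP[ci cj].
  exact: ij (coef_inj ci cj).
have -> : struct_coef w m i * struct_coef w m j = 0.
  apply/eqP/negPn/negP; rewrite mulf_eq0 negb_or => /andP[ci cj].
  exact: ij (coef_fun ci cj).
by rewrite !mulr0 addr0 mul0r.
Qed.

End RicciTensor.

Lemma exists_ricci_operator :
    (forall i j w m, struct_coef i w m * struct_coef j m w = 0) ->
    (forall i j k k', struct_coef i j k != 0 -> struct_coef i j k' != 0 -> k = k') ->
    (forall i i' j k, struct_coef i j k != 0 -> struct_coef i' j k != 0 -> i = i') ->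
  exists (ip : {dot g for idfun}) (Ric : 'End(g)),
    ricci_operator ip Ric /\ forall i : 'I_n, Ric e`_i = ricci_diag i *: e`_i.
Proof.
move=> acyclic cfun cinj.
have [ip ipE] := exists_coord_dot e_basis.
have [nabla nablaLC nablaE] := exists_levi_civita ipE.
pose f u := \sum_(i < n) (ricci_diag i * coord e i u) *: e`_i.
have f_lin : linear f.
  move=> a x y; rewrite /f scaler_sumr -big_split; apply: eq_bigr => i _ /=.
  by rewrite linearP /= scalerA -scalerDl; congr (_ *: _); ring.
pose fl : {linear g -> g} := HB.pack f (GRing.isLinear.Build R g g *:%R f f_lin).
have fE (i : 'I_n) : f e`_i = ricci_diag i *: e`_i.
  rewrite /f (bigD1 i) //= coord_basisE // eqxx mulr1 big1 ?addr0 // => j ji.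
  by rewrite coord_basisE // eq_sym (negPf ji) mulr0 scale0r.
exists ip, (linfun fl); split=> [|i]; last by rewrite lfunE.
exists nabla => // u v; rewrite ipE.
apply: (biscalar_ext e_basis (f := fun u v => coord_dot e (linfun fl u) v)
  (h := ricci_tensor nabla)).
- split=> [w a x y|w a x y] /=; last exact: coord_dotPr.
  by rewrite linearP coord_dotPl.
- exact: ricci_tensor_bilinear.
move=> i j; rewrite lfunE /= fE coord_dot_basis // linearZ /= coord_basisE //.
by rewrite ricci_tensor_diag // mulrC.
Qed.

End KoszulConnection.

(** * Supports and norms of structure coefficients, and rescaling *)

Section StructureCoefficients.
Context {R : realType} {g : lieAlgType R}.
Local Notation n := (\dim {:g}).

(** For a nice basis, the complement of this set indexes a basis of the center, and [in_indices] one
    of the derived ideal. *)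
Definition out_indices (e : n.-tuple g) : {set 'I_n} :=
  [set i | [exists w, exists m, struct_coef e i w m != 0]].

Definition in_indices (e : n.-tuple g) : {set 'I_n} :=
  [set i | [exists w, exists m, struct_coef e w m i != 0]].

Definition out_norm (e : n.-tuple g) (i : 'I_n) : R :=
  \sum_w \sum_m struct_coef e i w m ^+ 2.

Definition in_norm (e : n.-tuple g) (i : 'I_n) : R :=
  \sum_w \sum_m struct_coef e w m i ^+ 2.

Lemma ricci_diagE e i :
  ricci_diag e i = - 2^-1 * out_norm e i + 4^-1 * in_norm e i.
Proof.
rewrite !mulr_sumr -big_split; apply: eq_bigr => w _ /=.
by rewrite !mulr_sumr -big_split.
Qed.

Lemma sum_sqr_eq0 (c : 'I_n -> 'I_n -> R) :
  (\sum_w \sum_m c w m ^+ 2 == 0) = ~~ [exists w, exists m, c w m != 0].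
Proof.
rewrite psumr_eq0 => [|w _]; last by apply: sumr_ge0 => m _; exact: sqr_ge0.
rewrite negb_exists; apply/allP/forallP => [c0 w|c0 w _].
  rewrite negb_exists; apply/forallP => m; rewrite negbK.
  have := c0 w (mem_index_enum w).
  rewrite psumr_eq0 => [/allP/(_ m (mem_index_enum m))|k _]; last exact: sqr_ge0.
  by rewrite sqrf_eq0.
apply/eqP; rewrite big1 // => m _; apply/eqP; rewrite sqrf_eq0.
by have := c0 w; rewrite negb_exists => /forallP/(_ m); rewrite negbK.
Qed.

Lemma out_norm_eq0 e i : (out_norm e i == 0) = (i \notin out_indices e).
Proof. by rewrite sum_sqr_eq0 inE. Qed.

Lemma in_norm_eq0 e i : (in_norm e i == 0) = (i \notin in_indices e).
Proof. by rewrite sum_sqr_eq0 inE. Qed.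

Lemma out_norm_gt0 e i : (0 < out_norm e i) = (i \in out_indices e).
Proof.
rewrite lt_neqAle eq_sym out_norm_eq0 negbK andb_idr // => _.
by do 2![apply: sumr_ge0 => ? _]; exact: sqr_ge0.
Qed.

Lemma in_norm_gt0 e i : (0 < in_norm e i) = (i \in in_indices e).
Proof.
rewrite lt_neqAle eq_sym in_norm_eq0 negbK andb_idr // => _.
by do 2![apply: sumr_ge0 => ? _]; exact: sqr_ge0.
Qed.

Section Scaling.
Variables (X : n.-tuple g) (s : 'I_n -> R).
Hypothesis X_basis : basis_of fullv X.
Hypothesis s_neq0 : forall i, s i != 0.

Definition scaled_basis : n.-tuple g := [tuple s i *: X`_i | i < n].

Lemma nth_scaled_basis (i : 'I_n) : scaled_basis`_i = s i *: X`_i.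
Proof. by rewrite -tnth_nth tnth_mktuple. Qed.

Lemma scaled_basisE v :
  v = \sum_(i < n) (coord X i v / s i) *: scaled_basis`_i.
Proof.
rewrite [LHS](coord_fullv X_basis); apply: eq_bigr => i _.
by rewrite nth_scaled_basis scalerA divfK.
Qed.

Lemma scaled_basis_basis : basis_of fullv scaled_basis.
Proof.
rewrite basisEdim size_tuple leqnn andbT; apply/subvP => v _.
rewrite [v]scaled_basisE; apply: rpred_sum => i _; apply/rpredZ/memv_span.
by rewrite mem_nth ?size_tuple.
Qed.

Lemma struct_coef_scaled i j k :
  struct_coef scaled_basis i j k = s i * s j / s k * struct_coef X i j k.
Proof.
rewrite /struct_coef !nth_scaled_basis [X in coord _ _ X]scaled_basisE.
rewrite coord_sum_free ?(basis_free scaled_basis_basis) //.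
rewrite linearZl_LR linearZr_LR /= !linearZ /=; ring.
Qed.

(** Scaling keeps the zero pattern of the coefficients, and with it all that is used of niceness. *)
Lemma struct_coef_scaled_eq0 i j k :
  (struct_coef scaled_basis i j k == 0) = (struct_coef X i j k == 0).
Proof.
by rewrite struct_coef_scaled !mulf_eq0 invr_eq0 !(negPf (s_neq0 _)).
Qed.

Lemma out_indices_scaled : out_indices scaled_basis = out_indices X.
Proof.
apply/setP => i; rewrite !finset.in_set; apply: eq_existsb => w.
by apply: eq_existsb => m; rewrite struct_coef_scaled_eq0.
Qed.

Lemma in_indices_scaled : in_indices scaled_basis = in_indices X.
Proof.
apply/setP => i; rewrite !finset.in_set; apply: eq_existsb => w.
by apply: eq_existsb => m; rewrite struct_coef_scaled_eq0.
Qed.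

End Scaling.

End StructureCoefficients.

(** * Nice bases: combinatorics of the coefficients, center and derived ideal *)

Section NiceBasis.
Context {R : realType} {g : lieAlgType R}.
Local Notation n := (\dim {:g}).
Variable X : n.-tuple g.
Hypothesis X_nice : nice_basis X.

Let X_basis : basis_of fullv X. Proof. by case: X_nice. Qed.
Local Notation C := (struct_coef X).

Lemma nice_lie i j k : C i j k != 0 -> [Lie X`_i, X`_j] = C i j k *: X`_k.
Proof.
move=> Cijk; have [_ X_mono _] := X_nice.
have ij : i != j by apply: contraNneq Cijk => ->; rewrite struct_coefxx.
have [Xij|[k' [c c0 Xij]]] := X_mono i j ij.
  by rewrite /struct_coef Xij linear0 eqxx in Cijk.
move: Cijk; rewrite /struct_coef Xij linearZ /= coord_basisE //.
by have [->|] := eqVneq k' k; rewrite ?mulr0 ?eqxx // mulr1.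
Qed.

Lemma nice_coef_fun i j k k' : C i j k != 0 -> C i j k' != 0 -> k = k'.
Proof.
move=> /nice_lie Xij; rewrite {1}/struct_coef Xij linearZ /= coord_basisE //.
by have [//|] := eqVneq k k'; rewrite mulr0 eqxx.
Qed.

(** Otherwise {i, j} and {i', j} would be distinct pairs that share [j] and bracket into the same
    line, against the second condition. *)
Lemma nice_coef_inj i i' j k : C i j k != 0 -> C i' j k != 0 -> i = i'.
Proof.
move=> c c'; apply/eqP/negPn/negP => ii'.
have ij : i != j by apply: contraNneq c => ->; rewrite struct_coefxx.
have [_ _ /(_ i j i' j k _ _ c c' (nice_lie c) (nice_lie c'))] := X_nice.
have neq : [set i; j] != [set i'; j].
  by apply/eqP => /setP/(_ i); rewrite !inE eqxx (negPf ii') (negPf ij).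
by move=> /(_ neq) /pred0P/(_ j); rewrite /= !inE eqxx !orbT.
Qed.

(** Otherwise [X_m] is a multiple of [X_i, X_w] and [X_w] one of [X_j, X_m], so both lie in every
    term of the lower central series, which reaches 0. *)
Lemma nice_coef_acyclic (g_nilp : lie_nilpotent g) i j w m :
  C i w m * C j m w = 0.
Proof.
apply/eqP/negPn/negP; rewrite mulf_eq0 negb_or => /andP[c c'].
have [t Lt] := g_nilp.
have step u (a b d : 'I_n) : C a b d != 0 -> X`_b \in lower_central g u ->
    X`_d \in lower_central g u.+1.
  move=> cabd Xb; rewrite -[X`_d]scale1r -(mulVf cabd) -scalerA -nice_lie //.
  by rewrite rpredZ //; apply: memv_lie_prod; rewrite ?memvf.
have lower u : X`_w \in lower_central g u /\ X`_m \in lower_central g u.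
  elim: u => [|u [wu mu]]; first by split; exact: memvf.
  by split; [exact: step c' mu | exact: step c wu].
have [+ _] := lower t; rewrite Lt memv0 => /eqP /(congr1 (coord X w)) /eqP.
by rewrite linear0 coord_basisE // eqxx oner_eq0.
Qed.

Lemma coord_lie u v k :
  coord X k [Lie u, v] = \sum_l \sum_m coord X l u * (coord X m v * C l m k).
Proof.
rewrite (coord_bilinear_l X_basis); apply: eq_bigr => l _.
by rewrite (coord_bilinear X_basis) mulr_sumr.
Qed.

(** A nonzero bracket of basis vectors is a multiple of a single [X_k], so [X_k] itself lies in the
    derived ideal. *)
Lemma lie_derived_nice : lie_derived g = coord_span_set X (in_indices X).
Proof.
apply/eqP; rewrite eqEsubv; apply/andP; split.
  apply: lie_prodv_sub => x y _ _; apply/(mem_coord_span_set X_basis) => k kD.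
  rewrite coord_lie big1 // => l _; rewrite big1 // => m _.
  suff -> : C l m k = 0 by rewrite !mulr0.
  apply/eqP/negPn/negP => clmk; move: kD; rewrite inE => /existsP[].
  by exists l; apply/existsP; exists m.
apply/span_subvP => x /mapP[k]; rewrite mem_enum inE.
case/existsP => i /existsP[j cijk] ->.
rewrite -[X`_k]scale1r -(mulVf cijk) -scalerA -nice_lie // rpredZ //.
by apply: memv_lie_prod; exact: memvf.
Qed.

Lemma lie_center_nice : lie_center g = coord_span_set X (~: out_indices X).
Proof.
apply/vspaceP => v; apply/mem_lie_center/idP; last first.
  move/(mem_coord_span_set X_basis) => v0 y; apply: (coord_inj X_basis) => k.
  rewrite linear0 coord_lie big1 // => l _; rewrite big1 // => m _.
  have [->|clmk] := eqVneq (C l m k) 0; first by rewrite !mulr0.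
  rewrite v0 ?mul0r // !inE negbK; apply/existsP; exists m; apply/existsP.
  by exists k.
move=> v0; apply/(mem_coord_span_set X_basis) => i.
rewrite !inE negbK => /existsP[j /existsP[k cijk]].
  (* By [nice_coef_inj], coordinate [k] of [v, X_j] reduces to the single term v_i c_ijk, which
     forces v_i = 0. *)
  have /(congr1 (coord X k)) /eqP := v0 X`_j; rewrite linear0 coord_lie.
  rewrite (bigD1 i) //= (bigD1 j) //= coord_basisE // eqxx mul1r.
  rewrite big1 => [|m mj]; last by rewrite coord_basisE // eq_sym (negPf mj) mul0r mulr0.
  rewrite big1 => [|l li]; last first.
    rewrite big1 // => m _; rewrite coord_basisE //.
    have [<-|] := eqVneq j m; last by rewrite mul0r mulr0.
    suff -> : C l j k = 0 by rewrite !mulr0.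
    by apply/eqP; apply: contraNT li => cljk; apply/eqP; exact: nice_coef_inj cljk cijk.
by rewrite !addr0 mulf_eq0 (negPf cijk) orbF => /eqP.
Qed.

End NiceBasis.

(* Rescaling the exceptional basis vector by [t] multiplies its [out_norm] [a] *)
(* by [t ^+ 2] and its [in_norm] [b] by [t ^- 2]; [t ^+ 4 = u * b / (2 * a)].  *)
Lemma exists_scaling (R : realType) (a b u : R) : 0 < a -> 0 < b -> 0 < u ->
  exists2 t, t != 0 &
    Num.sg (- 2^-1 * (t ^+ 2 * a) + 4^-1 * (t ^- 2 * b)) = Num.sg (1 - u).
Proof.
move=> a0 b0 u0; set q := Num.sqrt (u * b / (2 * a)).
have qq : q ^+ 2 = u * b / (2 * a).
  by rewrite sqr_sqrtr // divr_ge0 ?mulr_ge0 ?ltW.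
have q0 : 0 < q by rewrite sqrtr_gt0 divr_gt0 ?mulr_gt0.
have tt : Num.sqrt q ^+ 2 = q by rewrite sqr_sqrtr // ltW.
exists (Num.sqrt q); first by rewrite gt_eqF // sqrtr_gt0.
have -> : - 2^-1 * (Num.sqrt q ^+ 2 * a) + 4^-1 * (Num.sqrt q ^- 2 * b) =
    b / 4 / q * (1 - u).
  rewrite tt.
  have -> : - 2^-1 * (q * a) = - 2^-1 * (q ^+ 2 * a) / q by field; rewrite gt_eqF.
  by rewrite qq; field; rewrite !gt_eqF.
by rewrite sgrM [Num.sg (b / 4 / q)]gtr0_sg ?mul1r // !divr_gt0.
Qed.

(** * Prescribing the sign of one Ricci eigenvalue *)

Section ScaledSignature.
Context {R : realType} {g : lieAlgType R}.
Local Notation n := (\dim {:g}).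
Variable X : n.-tuple g.
Hypothesis g_nilp : lie_nilpotent g.
Hypothesis X_nice : nice_basis X.

(** The parameter [u] selects the sign at [m]: positive, zero or negative as [u] is below, equal to
    or above 1. At the other indices considered, one of the two norms vanishes and the other is
    positive, whatever the scaling. *)
Lemma exists_ricci_sg (m : 'I_n) (u : R) : 0 < u ->
    m \in in_indices X -> m \in out_indices X ->
  exists (ip : {dot g for idfun}) (Ric : 'End(g)), ricci_operator ip Ric /\
    exists r : 'I_n -> R,
    [/\ signature Ric = (#|[set i | (r i < 0)%R]|, #|[set i | r i == 0]|,
                         #|[set i | (0 < r i)%R]|),
        Num.sg (r m) = Num.sg (1 - u),
        forall i, i \notin in_indices X -> i \in out_indices X -> r i < 0
      & forall i, i \in in_indices X -> i \notin out_indices X -> 0 < r i].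
Proof.
move=> u_gt0 m_in m_out; have [X_basis _ _] := X_nice.
have [t t0 sg_t] : exists2 t, t != 0 & Num.sg (- 2^-1 * (t ^+ 2 * out_norm X m) +
    4^-1 * (t ^- 2 * in_norm X m)) = Num.sg (1 - u).
  by apply: exists_scaling; rewrite ?out_norm_gt0 ?in_norm_gt0.
pose s i := if i == m then t else 1.
have s0 i : s i != 0 by rewrite /s; case: ifP; rewrite ?oner_eq0.
pose e := scaled_basis X s.
have e_basis : basis_of fullv e by exact: scaled_basis_basis.
have C0 i j k : (struct_coef e i j k == 0) = (struct_coef X i j k == 0).
  exact: struct_coef_scaled_eq0.
have acyclic i j w k : struct_coef e i w k * struct_coef e j k w = 0.
  by apply/eqP; rewrite mulf_eq0 !C0 -mulf_eq0 nice_coef_acyclic.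
have trX i w : struct_coef X i w w = 0.
  by apply/eqP; rewrite -sqrf_eq0 expr2 nice_coef_acyclic.
have trX' i w : struct_coef X w i w = 0 by rewrite struct_coefC trX oppr0.
have [||ip [Ric [RicE Ric_diag]]] := exists_ricci_operator e_basis acyclic.
- by move=> i j k k'; rewrite !C0; exact: nice_coef_fun.
- by move=> i i' j k; rewrite !C0; exact: nice_coef_inj.
exists ip, Ric; split=> //; exists (ricci_diag e); split.
- exact: (signature_diag e_basis Ric_diag).
- rewrite ricci_diagE -sg_t; congr (Num.sg (_ * _ + _ * _)).
    rewrite mulr_sumr; apply: eq_bigr => w _; rewrite mulr_sumr.
    apply: eq_bigr => k _; rewrite struct_coef_scaled // /s eqxx.
    (* A coefficient in which [m] occurs twice is 0, so every surviving one is scaled by exactly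
       [t], and below by its inverse. *)
    have [->|_] := eqVneq w m; first by rewrite struct_coefxx !mulr0 expr0n mulr0.
    have [->|_] := eqVneq k m; first by rewrite trX' !mulr0 expr0n mulr0.
    by rewrite mulr1 invr1 mulr1 exprMn.
  rewrite mulr_sumr; apply: eq_bigr => w _; rewrite mulr_sumr.
  apply: eq_bigr => k _; rewrite struct_coef_scaled // /s eqxx.
  have [->|_] := eqVneq w m; first by rewrite trX' !mulr0 expr0n mulr0.
  have [->|_] := eqVneq k m; first by rewrite trX !mulr0 expr0n mulr0.
  by rewrite !mul1r exprMn exprVn.
- move=> i; rewrite -(in_indices_scaled X_basis s0) -(out_indices_scaled X_basis s0).
  rewrite -in_norm_eq0 -out_norm_gt0 ricci_diagE => /eqP -> out_gt0.
  by rewrite mulr0 addr0 mulNr oppr_lt0 mulr_gt0 // invr_gt0.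
move=> i; rewrite -(in_indices_scaled X_basis s0) -(out_indices_scaled X_basis s0).
rewrite -in_norm_gt0 -out_norm_eq0 ricci_diagE => in_gt0 /eqP ->.
by rewrite mulr0 add0r mulr_gt0 // invr_gt0.
Qed.

End ScaledSignature.

(** * Counting the eigenvalues and realizing the three signatures *)

Theorem theorem3 (R : realType) (g : lieAlgType R)
    (g_nilp : lie_nilpotent g)
    (g_nice : exists X : (\dim {:g}).-tuple g, nice_basis X)
    (Z_sub : (lie_center g <= lie_derived g)%VS)
    (dimZ : (\dim (lie_derived g) - \dim (lie_center g) = 1)%N)
    (s : nat * nat * nat) (s_Sign : Sign g s) :
  exists (ip : {dot g for idfun}) (Ric : 'End(g)),
    ricci_operator ip Ric /\ signature Ric = s.
Proof.
have [X X_nice] := g_nice; have [X_basis _ _] := X_nice.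
set D := in_indices X; pose Z := ~: out_indices X.
have dimD : \dim (lie_derived g) = #|D|.
  by rewrite (lie_derived_nice X_nice) dim_coord_span_set.
have dimC : \dim (lie_center g) = #|Z|.
  by rewrite (lie_center_nice X_nice) dim_coord_span_set.
have ZD : Z \subset D.
  apply/fintype.subsetP => i iZ; apply/negPn/negP => iD.
  have : X`_i \in lie_derived g.
    apply: (subvP Z_sub); rewrite (lie_center_nice X_nice).
    apply/(mem_coord_span_set X_basis) => j jZ; rewrite coord_basisE //.
    by have [ij|//] := eqVneq i j; rewrite -ij iZ in jZ.
  rewrite (lie_derived_nice X_nice) => /(mem_coord_span_set X_basis)/(_ i iD)/eqP.
  by rewrite coord_basisE // eqxx oner_eq0.
have /cards1P[m DZm] : #|D :\: Z| == 1%N.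
  by rewrite cardsD (finset.setIidPr ZD) -dimD -dimC dimZ.
have mDZ i : (i == m) = (i \notin Z) && (i \in D).
  by have /setP/(_ i) := DZm; rewrite !inE => <-.
have [mZ mD] : m \notin Z /\ m \in D by apply/andP; rewrite -mDZ.
have [p [mm [m0 [mp [p_bound m_sum ->]]]]] := s_Sign.
(* The inclusion gives l = k, so p <= k - l forces p = 0, and exactly one of [mm], [m0], [mp] is
   1. *)
move: p_bound m_sum; rewrite (capv_idPl Z_sub) subnn dimZ leqn0 => /andP[_ /eqP ->] m_sum.
rewrite subn0 add0n dimC.
pose u : R := if mm == 1%N then 2 else if m0 == 1%N then 1 else 2^-1.
have u_gt0 : 0 < u by rewrite /u; do ?case: ifP => _; rewrite ?ltr01 ?invr_gt0 ?ltr0n.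
have mout : m \in out_indices X by move: mZ; rewrite inE negbK.
have [ip [Ric [RicE [r [sigE r_m r_neg r_pos]]]]] :=
  exists_ricci_sg g_nilp X_nice u_gt0 mD mout.
exists ip, Ric; split=> //; rewrite sigE.
(* An index other than [m] is either in [Z], hence central and positive, or outside [D], hence
   negative. *)
have r_sg i : i != m -> Num.sg (r i) = if i \in D then 1 else -1.
  rewrite mDZ negb_and negbK => /orP[iZ|iD].
    rewrite (fintype.subsetP ZD _ iZ) gtr0_sg // r_pos ?(fintype.subsetP ZD) //.
    by move: iZ; rewrite inE.
  rewrite (negPf iD) ltr0_sg // r_neg //.
  by have := contra (fintype.subsetP ZD i) iD; rewrite inE negbK.
have neg : [set i | r i < 0] :\ m = ~: D.
  apply/setP => i; rewrite finset.in_setD1 finset.in_setC [in LHS]finset.in_set.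
  have [->|im] := eqVneq i m; first by rewrite mD.
  by rewrite -sgr_lt0 r_sg //; case: ifP => _; rewrite ?ltr10 ?ltrN10.
have zero : [set i | r i == 0] :\ m = finset.set0.
  apply/setP => i; rewrite !inE; have [//|im] := eqVneq i m.
  by rewrite -sgr_eq0 r_sg //; case: ifP => _; rewrite ?oppr_eq0 oner_eq0.
have pos : [set i | 0 < r i] :\ m = Z.
  apply/setP => i; rewrite finset.in_setD1 [in LHS]finset.in_set.
  have [->|im] := eqVneq i m; first by rewrite (negPf mZ).
  move: (im); rewrite mDZ -sgr_gt0 r_sg // negb_and negbK /=.
  have [/(fintype.subsetP ZD) -> _|_ /= /negPf ->] := boolP (i \in Z).
    exact: ltr01.
  exact: ltr0N1.
have cardT : (#|~: D| = \dim {:g} - \dim (lie_derived g))%N.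
  have /(congr1 (subn^~ #|D|)) /= := cardsC D.
  by rewrite card_ord dimD addKn.
rewrite -cardT (cardsD1 m [set i | r i < 0]) (cardsD1 m [set i | r i == 0]).
rewrite (cardsD1 m [set i | 0 < r i]) neg zero pos cards0 !finset.in_set.
rewrite -(sgr_lt0 (r m)) -(sgr_eq0 (r m)) -(sgr_gt0 (r m)) r_m sgr_lt0 sgr_eq0 sgr_gt0.
rewrite addn0 (addnC _ #|~: D|) (addnC _ #|Z|) /u.
(* The triples (0,0,1), (0,1,0) and (1,0,0) remain, with 1 - u equal to 1/2, 0 and -1. *)
move: mm m0 mp m_sum {u u_gt0 r_m sigE} => [|[|?]] [|[|?]] [|[|?]] //= _.
- have -> : 1 - 2^-1 = 2^-1 :> R by field.
  by rewrite invr_gt0 ltr0n invr_eq0 pnatr_eq0 ltNge invr_ge0 ler0n.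
- by rewrite subrr ltxx eqxx.
have -> : 1 - 2 = -1 :> R by ring.
by rewrite ltrN10 ltr0N1 oppr_eq0 oner_eq0.
Qed.
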